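(* Let $n \ge 4$ be an even integer. Then $h(n) = n/2$.
   Context: $A_n$ is the alternating group of degree $n$, acting on $\mathbb{Z}_n = \mathbb{Z}/n\mathbb{Z} = \{0,1,\ldots,n-1\}$. Permutations act on the right (the image of $x$ under $\pi$ is $x^\pi$) and are composed from left to right. For $n$ even, let $c = (0,1,\ldots,n-1)^2 \in A_n$, the square of the $n$-cycle $(0,1,\ldots,n-1)$, i.e. $x^c = x+2$. For $\pi \in A_n$, $[\pi] = \langle c\rangle \pi$ is the coset of $\langle c \rangle$ containing $\pi$; its elements are the permutations $c^j\pi$ (first $c^j$, then $\pi$). Define $h(\pi)$ to be the minimum number of 3-cycles in an expression of $\pi$ as a product of (not necessarily disjoint) 3-cycles in $A_n$, with $h(\mathrm{id}) = 0$. Define $h([\pi]) = \min_{\sigma \in [\pi]} h(\sigma) = \min_{0 \le j \le n-1} h(c^j\pi)$ and $h(n) = \max_{\pi \in A_n} h([\pi])$. *)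

(* Defs.v *)
From mathcomp Require Import all_boot all_order all_algebra.
From mathcomp Require Import all_fingroup all_solvable.

Set Implicit Arguments.
Unset Strict Implicit.
Unset Printing Implicit Defensive.

Local Open Scope group_scope.

Section ThreeCycles.

Variable T : finType.
Implicit Types (s t pi : {perm T}) (k m : nat).

Definition is_3cycle s : bool :=
  [exists x, exists y, exists z,
    [&& uniq [:: x; y; z], s x == y, s y == z, s z == x
      & perm_on [set x; y; z] s]].

(* Products of permutations act from left to right: (s * t) x = t (s x). *)
Definition prod_3cycles k pi : bool :=
  [exists t : k.-tuple {perm T},
    all is_3cycle t && (pi == \prod_(s <- t) s)].

Lemma prod_3cycles0 : prod_3cycles 0 1.
Proof. by apply/existsP; exists [tuple]; rewrite big_nil eqxx. Qed.

Lemma prod_3cyclesM k m s t :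
  prod_3cycles k s -> prod_3cycles m t -> prod_3cycles (k + m) (s * t).
Proof.
move=> /existsP[u /andP[cu /eqP->]] /existsP[v /andP[cv /eqP->]].
by apply/existsP; exists [tuple of u ++ v]; rewrite all_cat cu cv big_cat eqxx.
Qed.

Lemma prod_3cycles_tpermM2 x y z :
  x != y -> y != z -> exists k, prod_3cycles k (tperm x y * tperm y z).
Proof.
move=> xy yz; have [<-|xz] := eqVneq x z.
  by exists 0; rewrite (tpermC y x) tperm2 prod_3cycles0.
exists 1%N; apply/existsP; exists [tuple tperm x y * tperm y z].
rewrite big_seq1 eqxx andbT /= andbT.
apply/existsP; exists x; apply/existsP; exists z; apply/existsP; exists y.
rewrite /= !inE negb_or xz xy (eq_sym z) yz /= !permM.
have -> : tperm x y z = z by rewrite tpermD // eq_sym.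
have -> : tperm x y y = x by rewrite tpermR.
have -> : tperm y z x = x by rewrite tpermD // eq_sym.
rewrite !(tpermL, tpermR) !eqxx /=.
apply/subsetP => w; rewrite !inE permM; apply: contraR.
rewrite !negb_or => /andP[/andP[wx wz] wy].
by rewrite !tpermD // eq_sym.
Qed.

Lemma prod_3cycles_Alt pi :
  exists k, (pi \in 'Alt_T) ==> prod_3cycles k pi.
Proof.
have [ts -> dts] := prod_tpermP pi; rewrite Alt_even odd_perm_prod //.
have [n] := ubnP (size ts); elim: n => // n IHn in ts dts *.
case: ts dts => [|[a b] [|[c d] ts]] /=.
- by exists 0; rewrite big_nil prod_3cycles0.
- by exists 0.
case/and3P=> ab cd dts lt_n.
have [|k Hk] := IHn ts dts; first by rewrite -ltnS ltnW.
rewrite negbK; case: (boolP (odd (size ts))) Hk => [|_] Hk; first by exists 0.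
have [m Hm] : exists m, prod_3cycles m (tperm a b * tperm c d).
  case: (eqVneq b c) ab => [-> | bc] ab; first exact: prod_3cycles_tpermM2.
  have [k1 H1] := prod_3cycles_tpermM2 ab bc.
  have [k2 H2] := prod_3cycles_tpermM2 bc cd.
  exists (k1 + k2); have := prod_3cyclesM H1 H2.
  by rewrite -mulgA (mulgA (tperm b c)) tperm2 mul1g.
exists (m + k); rewrite !big_cons mulgA /=.
exact: prod_3cyclesM Hm Hk.
Qed.

(* The guard makes the minimum exist for every pi; for pi outside the
   alternating group the value is 0 and carries no meaning. *)
Definition h3 pi : nat := ex_minn (prod_3cycles_Alt pi).

End ThreeCycles.

Section RotationCosets.

Variable n : nat.
Implicit Types pi : {perm 'Z_n}.

(* 'Z_n is the ring of integers modulo n only for n > 1. *)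
Definition rot1 : {perm 'Z_n} := perm (GRing.addIr (1%R : 'Z_n)).

Definition rot2 : {perm 'Z_n} := rot1 ^+ 2.

Lemma rot2E (x : 'Z_n) : rot2 x = (x + 2%:R)%R.
Proof. by rewrite /rot2 expgS expg1 permM !permE -GRing.addrA. Qed.

Definition rot2_coset pi : {set {perm 'Z_n}} := <[rot2]> :* pi.

(* The initial value h3 pi is among the values minimised over, since pi lies
   in its own coset. *)
Definition h_coset pi : nat :=
  \big[minn/h3 pi]_(sigma in rot2_coset pi) h3 sigma.

Definition h_max : nat := \max_(pi in 'Alt_('Z_n)) h_coset pi.

End RotationCosets.

(* Main.v *)
Require Import Defs.
From mathcomp Require Import all_boot.
From mathcomp Require Import all_algebra all_fingroup all_solvable.

(**
  Upper bound: an even permutation is a product of at most half as many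
  3-cycles as it has moved points.  If [x -> y -> z] is part of a cycle of
  length at least 3, one 3-cycle splits off two fixed points; otherwise the
  permutation is an involution, being even it contains two disjoint
  transpositions, and these are the product of two 3-cycles.

  Lower bound: for every set [A], a 3-cycle moves at most one point of [A] out
  of [A], so a product of [k] 3-cycles moves at most [k] points of [A] out of
  [A].  The rotation by 2 preserves parity, so if [pi] exchanges the even and
  the odd residues, every element of its coset moves all [n/2] even residues
  out of their set.  The rotation by 1 and its product with the transposition
  (0, 2) both exchange them, and one of the two is an even permutation.
*)

Set Implicit Arguments.
Unset Strict Implicit.
Unset Printing Implicit Defensive.

Local Open Scope group_scope.

Section ThreeCycleProducts.

Variable T : finType.
Implicit Types (x y z w : T) (s t pi : {perm T}) (A : {set T}).

Lemma prod_3cycles1 x y z :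
  uniq [:: x; y; z] -> prod_3cycles 1 (tperm x y * tperm x z).
Proof.
rewrite /= !inE negb_or andbT => /andP[/andP[xy xz] yz].
apply/existsP; exists [tuple tperm x y * tperm x z].
rewrite big_seq1 eqxx andbT /= andbT.
apply/existsP; exists x; apply/existsP; exists y; apply/existsP; exists z.
rewrite /= !inE negb_or xy xz yz /= !permM tpermL tpermR tpermL.
rewrite (tpermD xz yz) tpermR (tpermD xy) ?(eq_sym z) // !eqxx /=.
apply/subsetP => w; rewrite !inE permM; apply: contraR.
rewrite !negb_or => /andP[/andP[wx wy] wz].
by rewrite !tpermD // eq_sym.
Qed.

(** Inserting [tperm y z] twice between the two transpositions regroups the product into two
    3-cycles. *)
Lemma prod_3cycles2_tperm x y z w :
  uniq [:: x; y; z; w] -> prod_3cycles 2 (tperm x y * tperm z w).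
Proof.
rewrite /= !inE !negb_or andbT.
case/and3P=> /and3P[xy xz xw] /andP[yz yw] zw.
have -> : tperm x y * tperm z w
    = (tperm y x * tperm y z) * (tperm z y * tperm z w).
  by rewrite -mulgA (mulgA (tperm y z)) (tpermC z y) tperm2 mul1g (tpermC y x).
by apply: (@prod_3cyclesM _ 1 1); apply: prod_3cycles1;
  rewrite /= !inE negb_or ?(eq_sym y x) ?(eq_sym z y) ?xy ?yz ?xz ?zw ?yw.
Qed.

Definition moved pi := [set x | pi x != x].

(** Counts one reduction step: [s] fixes what [pi] fixes, so [moved (s * pi)] lies in [moved pi]
    minus [D]. *)
Lemma moved_sub_fixed s pi (D : {set T}) :
    (forall x, x \notin moved pi -> s x = x) ->
    D \subset moved pi -> (forall x, x \in D -> (s * pi) x = x) ->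
  #|moved (s * pi)| + #|D| <= #|moved pi|.
Proof.
move=> fix_s sDm fixD; rewrite -(cardsID D (moved pi)) addnC.
rewrite (setIidPr sDm) leq_add2l subset_leq_card //.
apply/subsetP=> x; rewrite inE => spx; rewrite inE; apply/andP; split.
  by apply: contra spx => /fixD->.
by apply: contraR spx => nmx; rewrite permM fix_s //; rewrite inE negbK in nmx.
Qed.

Lemma Alt_prod_3cycles_leq pi :
  pi \in 'Alt_T -> exists2 k, k.*2 <= #|moved pi| & prod_3cycles k pi.
Proof.
rewrite Alt_even; have [m] := ubnP #|moved pi|; elim: m => // m IHm in pi *.
rewrite ltnS => le_m ev_pi.
case: (boolP [exists x, pi (pi x) != x]) => [/existsP[x ppx] | ].
  set y := pi x in ppx; set z := pi y in ppx.
  have xy : y != x by apply: contraNneq ppx => yx; rewrite /z yx -/y yx.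
  have yz : z != y by rewrite (inj_eq perm_inj).
  have Dxy : x != y by rewrite eq_sym.
  have Dxz : x != z by rewrite eq_sym.
  have Dyz : y != z by rewrite eq_sym.
  (* [s] sends [y] to [x] and [z] to [y], so [s * pi] fixes both; the inverse of [s] is the 3-cycle
     split off. *)
  set s := tperm x z * tperm x y.
  have le_s : #|moved (s * pi)| + #|[set y; z]| <= #|moved pi|.
    apply: moved_sub_fixed => [u||u].
    - rewrite inE negbK => /eqP fu; rewrite permM.
      have ux : x != u by apply: contraNneq xy => xu; rewrite /y xu fu.
      have uy : y != u by apply: contraNneq yz => yu; rewrite /z yu fu.
      have uz : z != u.
        apply: contraNneq yz => zu; apply/eqP.
        by apply: (@perm_inj _ pi); rewrite -/z zu fu.
      by rewrite !tpermD.
    - apply/subsetP=> u /set2P[]->; rewrite inE //.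
      by rewrite -/z (inj_eq perm_inj).
    case/set2P=> ->; rewrite !permM.
      by rewrite (tpermD Dxy yz) tpermR.
    by rewrite tpermR tpermL.
  rewrite cards2 Dyz in le_s.
  have [||k le_k pk] := IHm (s * pi).
  - apply: leq_trans le_m; apply: leq_trans le_s.
    by rewrite addn2 ltnS leqnSn.
  - by rewrite !odd_permM !odd_tperm Dxy Dxz.
  exists k.+1; first by rewrite doubleS -addn2 (leq_trans _ le_s) // leq_add2r.
  have -> : pi = (tperm x y * tperm x z) * (s * pi).
    by rewrite /s !mulgA -(mulgA (tperm x y)) tperm2 mulg1 tperm2 mul1g.
  apply: (@prod_3cyclesM _ 1) pk; apply: prod_3cycles1.
  by rewrite /= !inE negb_or Dxy Dxz Dyz.
rewrite negb_exists => /forallP pp.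
have ppE u : pi (pi u) = u by have := pp u; rewrite negbK => /eqP.
have [m0|[x]] := set_0Vmem (moved pi).
  have -> : pi = 1.
    apply/permP=> u; rewrite perm1; apply/eqP.
    by have := in_set0 u; rewrite -m0 inE => /negbFE.
  by exists 0; rewrite ?prod_3cycles0.
rewrite inE => xy.
have Dxy : x != pi x by rewrite eq_sym.
(* An involution moving only [x] and [pi x] would be a transposition, hence odd. *)
have [z zm zxy] : exists2 z, pi z != z & z \notin [set x; pi x].
  apply/exists_inP; apply: contraLR ev_pi; rewrite negb_exists_in negbK.
  move=> /forall_inP fx; have -> : pi = tperm x (pi x).
    apply/permP=> u; case: tpermP => [->|->|/eqP ux /eqP uy] //.
    by apply/eqP; apply: contraTT isT => /fx; rewrite !inE negb_or ux uy.
  by rewrite odd_tperm Dxy.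
set y := pi x in xy Dxy zxy; set w := pi z in zm.
move: zxy; rewrite !inE negb_or => /andP[zx zy].
have py : pi y = x by rewrite ppE.
have pw : pi w = z by rewrite ppE.
have wx : w != x by apply: contraNneq zy => wx; rewrite -pw wx.
have wy : w != y by rewrite (inj_eq perm_inj).
have Dxz : x != z by rewrite eq_sym.
have Dyz : y != z by rewrite eq_sym.
have Dxw : x != w by rewrite eq_sym.
have Dyw : y != w by rewrite eq_sym.
have Dzw : z != w by rewrite eq_sym.
(* [s] agrees with [pi] on two of its 2-cycles, so four points become fixed at the cost of two
   3-cycles. *)
set s := tperm x y * tperm z w.
have le_s : #|moved (s * pi)| + #|[set x; y; z; w]| <= #|moved pi|.
  apply: moved_sub_fixed => [u||u].
  - rewrite inE negbK => /eqP fu; rewrite permM.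
    have ux : x != u by apply: contraNneq xy => xu; rewrite /y xu fu.
    have uy : y != u by apply: contraNneq xy => yu; rewrite -py yu fu.
    have uz : z != u by apply: contraNneq zm => zu; rewrite /w zu fu.
    have uw : w != u by apply: contraNneq zm => wu; rewrite -pw wu fu.
    by rewrite !tpermD.
  - apply/subsetP=> u; rewrite !inE -!orbA.
    by case/or4P=> /eqP->; rewrite ?py ?pw.
  rewrite !inE -!orbA !permM => /or4P[]/eqP->.
  - by rewrite tpermL tpermD // ppE.
  - by rewrite tpermR tpermD.
  - by rewrite (tpermD Dxz Dyz) tpermL ppE.
  by rewrite (tpermD Dxw Dyw) tpermR.
have c4 : #|[set x; y; z; w]| = 4.
  by rewrite setUC cardsU1 setUC cardsU1 cards2 !inE !negb_or Dxy wx wy zm zx zy.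
rewrite c4 in le_s.
have [||k le_k pk] := IHm (s * pi).
- apply: leq_trans le_m; apply: leq_trans le_s.
  by rewrite -[X in X < _]addn0 ltn_add2l.
- by rewrite !odd_permM !odd_tperm Dxy Dzw.
exists (2 + k).
  by rewrite doubleD addnC (leq_trans _ le_s) // leq_add2r.
(* Disjoint transpositions commute, so [s] is its own inverse. *)
have ss : s * s = 1.
  have cs : s = tperm z w * tperm x y.
    by rewrite /s conjgC tpermJ (tpermD zx wx) (tpermD zy wy).
  by rewrite {1}cs /s mulgA -(mulgA (tperm z w)) tperm2 mulg1 tperm2.
have -> : pi = s * (s * pi) by rewrite mulgA ss mul1g.
apply: prod_3cyclesM pk; apply: prod_3cycles2_tperm.
by rewrite /= !inE !negb_or Dxy Dxz Dxw Dyz Dyw Dzw.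
Qed.

Lemma h3_leq k pi : pi \in 'Alt_T -> prod_3cycles k pi -> h3 pi <= k.
Proof.
by rewrite /h3 => piA pk; case: ex_minnP => m _; apply; rewrite piA.
Qed.

Lemma prod_3cycles_h3 pi : pi \in 'Alt_T -> prod_3cycles (h3 pi) pi.
Proof. by rewrite /h3 => piA; case: ex_minnP => m; rewrite piA. Qed.

Lemma h3_leq_half pi : pi \in 'Alt_T -> h3 pi <= #|T|./2.
Proof.
move=> piA; have [k le_k pk] := Alt_prod_3cycles_leq piA.
apply: leq_trans (h3_leq piA pk) _.
by rewrite -(doubleK k) half_leq // (leq_trans le_k) ?max_card.
Qed.

(* If two points enter [s @: A] from outside [A], they and their preimages
   are four distinct points among the three that [s] moves. *)
Lemma card_3cycle_imsetD s A : is_3cycle s -> #|(s @: A) :\: A| <= 1.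
Proof.
case/existsP=> x /existsP[y /existsP[z]].
case/and5P=> _ /eqP sx /eqP sy /eqP sz on_s.
apply/card_le1_eqP=> u v; rewrite !inE.
have mv a : a \in A -> s a \notin A -> a \in [set x; y; z].
  move=> aA sA; apply: (subsetP on_s); rewrite inE.
  by apply: contraNneq sA => /= ->.
case/andP=> uA /imsetP[a aA ua] /andP[vA /imsetP[b bA vb]].
have := mv a aA; have := mv b bA; rewrite -ua -vb => /(_ vA) + /(_ uA).
(* Unless [a = b], one image is the other preimage, hence both in and outside [A]. *)
rewrite !inE -!orbA => /or3P[]/eqP eb /or3P[]/eqP ea;
  move: uA vA aA bA; rewrite ua vb ea eb ?sx ?sy ?sz //;
  by case: (x \in A); case: (y \in A); case: (z \in A).
Qed.

Lemma card_prod_3cycles_imsetD k pi A :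
  prod_3cycles k pi -> #|(pi @: A) :\: A| <= k.
Proof.
case/existsP=> t /andP[ct /eqP->]; rewrite -[X in _ <= X](size_tuple t).
elim: (tval t) ct A => [|s ss IHs] /= ct A.
  rewrite big_nil [X in X :\: _](_ : _ = A) ?setDv ?cards0 //.
  rewrite -[RHS]imset_id; apply: eq_imset => u; exact: perm1.
case/andP: ct => cs css; rewrite big_cons.
set p := \prod_(_ <- _) _.
have -> : (s * p) @: A = p @: (s @: A).
  by rewrite -imset_comp; apply: eq_imset => u; rewrite permM.
(* A point of the final image outside [A] is either new relative to [s @: A] or already outside [A]
   after [s]. The first kind needs the induction hypothesis at [s @: A], so [A] is kept general. *)
have sD : (p @: (s @: A)) :\: A
    \subset ((p @: (s @: A)) :\: (s @: A)) :|: ((s @: A) :\: A).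
  by apply/subsetP=> u; rewrite !inE => /andP[-> ->]; rewrite !andbT orNb.
apply: leq_trans (subset_leq_card sD) _.
apply: leq_trans (leq_card_setU _ _) _.
by rewrite -addn1 leq_add ?IHs ?card_3cycle_imsetD.
Qed.

Lemma card_swap_leq_h3 pi A :
  pi \in 'Alt_T -> pi @: A = ~: A -> #|~: A| <= h3 pi.
Proof.
move=> piA sw; have := card_prod_3cycles_imsetD A (prod_3cycles_h3 piA).
by rewrite sw setDE setIid.
Qed.

End ThreeCycleProducts.

(** Reduction modulo the even number [n.+2] preserves parity. *)
Lemma odd_rot1 n (x : 'Z_n.+2) : ~~ odd n -> odd (rot1 n.+2 x) = ~~ odd x.
Proof.
move=> en; rewrite /rot1 permE /=.
by rewrite odd_mod /= ?negbK ?(negPf en) // oddD modn_small //= addbT.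
Qed.

Lemma h_coset_leq n (pi : {perm 'Z_n}) : h_coset pi <= h3 pi.
Proof.
rewrite /h_coset; elim/big_rec: _ => // s m _ le_m.
exact: leq_trans (geq_minr _ _) le_m.
Qed.

Theorem theorem2p4 (n : nat) (hn : 4 <= n) (neven : ~~ odd n) :
  h_max n = n./2.
Proof.
case: n hn neven => [|[|n]] // hn; rewrite /= negbK => en.
apply/eqP; rewrite eqn_leq; apply/andP; split.
  apply/bigmax_leqP=> pi piA; apply: leq_trans (h_coset_leq pi) _.
  by have := h3_leq_half piA; rewrite card_ord.
pose swaps (s : {perm 'Z_n.+2}) := forall x : 'Z_n.+2, odd (s x) = ~~ odd x.
have [pi piA sw_pi] : exists2 pi, pi \in 'Alt_('Z_n.+2) & swaps pi.
  have sw1 : swaps (rot1 n.+2) by move=> x; apply: odd_rot1.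
  case: (boolP (odd_perm (rot1 n.+2))) => [o1|e1]; last first.
    by exists (rot1 n.+2); rewrite // Alt_even.
  (* Swapping the even residues 0 and 2 changes the sign but no parity; [hn] keeps 2 below the
     modulus. *)
  pose a : 'Z_n.+2 := inord 2.
  have a2 : a = 2 :> nat by rewrite inordK //; apply: ltnW hn.
  have a0 : ord0 != a by rewrite -val_eqE /= a2.
  exists (rot1 n.+2 * tperm ord0 a).
    by rewrite Alt_even odd_permM o1 odd_tperm a0.
  move=> x; rewrite permM -sw1.
  by case: tpermP => [->|->|//]; rewrite a2.
apply: leq_trans (leq_bigmax_cond _ piA).
pose E := [set x : 'Z_n.+2 | ~~ odd x].
have imE (s : {perm 'Z_n.+2}) : swaps s -> s @: E = ~: E.
  move=> sw; apply/setP=> x; rewrite -[x](permKV s) mem_imset; last exact: perm_inj.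
  by rewrite !inE sw negbK.
(* [pi] carries [E] bijectively onto its complement, so each is half of the residues. *)
have cardE : #|~: E| = n.+2./2.
  have := cardsC E; rewrite -{1}(card_imset _ (@perm_inj _ pi)) imE //.
  by rewrite addnn card_ord => /(congr1 half); rewrite doubleK.
have ge_h s : s \in rot2_coset pi -> n.+2./2 <= h3 s.
  (* [rot2] is even, being a square, and preserves parity, so the whole coset inherits both
     properties of [pi]. *)
  case/rcosetP=> _ /cycleP[j ->] ->; rewrite -cardE.
  apply: card_swap_leq_h3.
    rewrite groupM // groupX // Alt_even /rot2 expgS expg1.
    by rewrite odd_permM addbb.
  apply: imE => x; rewrite permM sw_pi; congr (~~ _).
  elim: j => [|j IHj]; first by rewrite perm1.
  by rewrite expgSr permM -IHj /rot2 expgS expg1 permM !odd_rot1 // negbK.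
(* [h3 pi], the initial value of the minimum, needs the bound as well. *)
rewrite /h_coset; elim/big_ind: _ => [|s t ls lt|s /ge_h//].
  by apply: ge_h; apply: rcoset_refl.
by rewrite leq_min ls.
Qed.
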